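(* Let $G$ be a finite graph with arbitrary probabilities on its edges, let $A\subset G$ be a nonempty set of vertices, and let $0,b\in G\setminus A$ be two distinct vertices. Assume that for some $x\in G\setminus A$, $x\ne 0$, the quadruple $(G\setminus\{0\},A,x,b)$ is good and that $0$ is isolated in $G\setminus(A\cup\{x\})$ (i.e. every neighbour of $0$ in $G$ belongs to $A\cup\{x\}$). Then $(G,A,0,b)$ is good.
   Context: A graph is identified with its vertex set. Each edge $e\in E(G)$ carries a number $p(e)\in[0,1]$, and $\omega\subseteq E(G)$ is a random set of edges in which every edge $e$ is included (is ''open'') with probability $p(e)$, independently; $\mathbb{P}=\mathbb{P}_G$ is the resulting probability measure. $v\leftrightarrow w$ is the event that $v$ and $w$ are connected by a path of open edges (or $v=w$). $\mathcal{C}(v)=\{w: v\leftrightarrow w\}$ is the cluster of $v$. For a set of vertices $W$, $G\setminus W$ is the graph obtained by deleting the vertices of $W$ and all edges touching them (the other edges keep their probabilities), and $\mathbb{P}_{G\setminus W}$ is percolation on it. Definition (good). Let $H$ be a graph with edge probabilities, $A\subset H$ and $u,b\in H$ such that $u$ and $b$ are in disjoint components of $H\setminus A$. The quadruple $(H,A,u,b)$ is good if $$\mathbb{P}_H(u\leftrightarrow b)\ \ge\ \min_{a\in A}\mathbb{P}_H(a\leftrightarrow b)-\sum_{W\cap A=\emptyset}\mathbb{P}_H(\mathcal{C}(u)=W)\,\min_{a\in A}\mathbb{P}_{H\setminus W}(a\leftrightarrow b),$$ where the sum is over sets of vertices $W\subset H$ disjoint from $A$ (only terms with $\mathbb{P}_H(\mathcal{C}(u)=W)>0$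 contribute, and for these $b\notin W$). The condition that $u$ and $b$ are in disjoint components of $H\setminus A$ is part of the assertion that the quadruple is good. *)

(* Defs.v *)
From HB Require Import structures.
From mathcomp Require Import all_boot all_order all_algebra.
From mathcomp Require Import reals.

Set Implicit Arguments.
Unset Strict Implicit.
Unset Printing Implicit Defensive.

Import Order.TTheory GRing.Theory Num.Theory.
Local Open Scope ring_scope.

(* Finite simple graphs whose vertices form a subset of an ambient finite type
   [T], so that vertex deletion stays within one type and edges (two-element
   sets of vertices) keep their names, hence their probabilities. *)
Record graph (T : finType) := Graph {
  vset : {set T};
  eset : {set {set T}};
  eset_wf : [forall e in eset, (e \subset vset) && (#|e| == 2)]
}.

Section Deletion.
Variables (T : finType) (G : graph T) (W : {set T}).

Definition del_eset : {set {set T}} := [set e in eset G | [disjoint e & W]].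

Lemma del_eset_wf :
  [forall e in del_eset, (e \subset vset G :\: W) && (#|e| == 2)].
Proof.
apply/forall_inP => e; rewrite inE => /andP[eG eW].
have /forall_inP/(_ e eG)/andP[eV ->] := eset_wf G.
by rewrite subsetD eV eW.
Qed.

Definition delv : graph T := Graph del_eset_wf.

End Deletion.

Section Percolation.
Variable T : finType.
Implicit Types (F : {set {set T}}) (G H : graph T) (A W : {set T}).

Definition connected F (v w : T) : bool :=
  connect (fun y z : T => [set y; z] \in F) v w.

Definition cluster F (v : T) : {set T} := [set w | connected F v w].

Definition component G (v : T) : {set T} := cluster (eset G) v.

Definition isolated G (v : T) : bool :=
  (v \in vset G) && [forall e in eset G, v \notin e].

Variables (R : realType) (p : {set T} -> R).

Definition weight G (omega : {set {set T}}) : R :=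
  \prod_(e in eset G) (if e \in omega then p e else 1 - p e).

Definition Pr G (E : pred {set {set T}}) : R :=
  \sum_(omega in powerset (eset G) | E omega) weight G omega.

Definition prConn G (v w : T) : R := Pr G (fun omega => connected omega v w).

Definition prCluster G (v : T) W : R := Pr G (fun omega => cluster omega v == W).

(* The minimum over a nonempty [A]: the default value 1 is neutral because
   probabilities are at most 1. *)
Definition minConn G A (b : T) : R := \big[Num.min/1]_(a in A) prConn G a b.

(* Summands with [b \in W] vanish: by the condition on components, the cluster
   of [u] cannot contain [b] while avoiding [A]. *)
Definition good H A (u b : T) : Prop :=
  [/\ A \subset vset H,
      u \in vset (delv H A),
      b \in vset (delv H A),
      [disjoint component (delv H A) u & component (delv H A) b]
    & minConn H A b
        - \sum_(W in powerset (vset H) | [disjoint W & A])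
            prCluster H u W * minConn (delv H W) A b
      <= prConn H u b].

End Percolation.

(* Main.v *)
(** Let H = G \ {0} and let a minimise P_H(a <-> b) over A. Condition on the set N
    of open neighbours of 0, which lies in A u {x}; it suffices to show, for every
    value of N, that
      P(0 <-> b | N) + E[1{C(0) misses A} min_A P_{G \ C(0)}(. <-> b) | N]
        >= P(a <-> b | N).
    If N is empty the second term is min_A P_H(. <-> b) = P_H(a <-> b); if N = {x}
    the inequality is the goodness of (H, A, x, b). If N contains some s in A, put
    S = {0} union N; both sides agree when a is joined to S in H, so the claim is
    P_H(S -/- {a, b}) <= P_H(a -/- S union {b}), which follows from
    P_H(a <-> b) <= P_H(s <-> b) by two applications of the van den Berg-Kahn
    inequality
      P(A -/- X) P(B -/- Y) <= P(A u B -/- X n Y) P(A n B -/- X u Y).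
    The latter is proved by revealing the edges at a common source and applying
    the four functions theorem to them. *)

Require Import Defs.
From HB Require Import structures.
From mathcomp Require Import all_boot all_order all_algebra.
From mathcomp Require Import reals.
From mathcomp Require Import lra ring.

Set Implicit Arguments.
Unset Strict Implicit.
Unset Printing Implicit Defensive.

Import Order.TTheory GRing.Theory Num.Theory.
Local Open Scope ring_scope.

Lemma set_ind (E : finType) (P : {set E} -> Prop) :
  P set0 -> (forall e (F : {set E}), e \notin F -> P F -> P (e |: F)) ->
  forall F, P F.
Proof.
move=> P0 PS F; have [n] := ubnP #|F|; elim: n F => // n IH F.
have [->//|[e eF]] := set_0Vmem F.
rewrite (cardsD1 e) eF ltnS => lt; rewrite -(setD1K eF).
by apply: PS; [rewrite setD11|apply: IH].
Qed.

(** * Expectations under product measures and the four functions theorem *)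

Section Expectation.
Variables (R : realFieldType) (E : finType) (p : E -> R).
Implicit Types (F w : {set E}) (f g : {set E} -> R).

(** Real-valued integrands and an arbitrary set [F], rather than events on a whole graph, allow some
    edges to be revealed while the others are averaged out. *)
Definition Ex F f : R :=
  \sum_(w in powerset F) (\prod_(e in F) (if e \in w then p e else 1 - p e)) * f w.

Lemma eq_Ex F f g : (forall w, w \subset F -> f w = g w) -> Ex F f = Ex F g.
Proof. by move=> fg; apply: eq_bigr => w; rewrite powersetE => /fg ->. Qed.

Lemma Ex_set0 f : Ex set0 f = f set0.
Proof. by rewrite /Ex powerset0 big_set1 big_set0 mul1r. Qed.

Lemma Ex_add F f g : Ex F (fun w => f w + g w) = Ex F f + Ex F g.
Proof. by rewrite -big_split; apply: eq_bigr => w _; rewrite mulrDr. Qed.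

Lemma Ex_scale F (c : R) f : Ex F (fun w => c * f w) = c * Ex F f.
Proof. by rewrite mulr_sumr; apply: eq_bigr => w _; rewrite mulrCA. Qed.

Lemma Ex_sum (I : finType) (P : pred I) F (f : I -> {set E} -> R) :
  Ex F (fun w => \sum_(i | P i) f i w) = \sum_(i | P i) Ex F (f i).
Proof.
by rewrite exchange_big; apply: eq_bigr => w _; rewrite mulr_sumr.
Qed.

(** Conditioning on the state of [e]: adding and removing [e] matches the configurations containing
    it with those of [F]. The inductions on edge sets below rest on this recursion. *)
Lemma Ex_setU1 F (e : E) f : e \notin F ->
  Ex (e |: F) f = Ex F (fun w => (1 - p e) * f w + p e * f (e |: w)).
Proof.
move=> eF; rewrite /Ex (bigID (fun w : {set E} => e \in w)) /= addrC.
under [RHS]eq_bigr do rewrite mulrDr; rewrite big_split; congr (_ + _).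
  apply: eq_big => [w|w /andP[_ ew]].
    rewrite !powersetE; apply/andP/idP => [[wF ew]|wF].
      by rewrite -(setU1K eF) subsetD1 wF ew.
    split; first exact: subset_trans wF (subsetUr _ _).
    by apply: contra eF; apply: (subsetP wF).
  by rewrite big_setU1 //= (negbTE ew) mulrCA mulrA.
rewrite (reindex_onto (fun w => e |: w) (fun w => w :\ e)) /=; last first.
  by move=> w /andP[_ ew]; rewrite setD1K.
apply: eq_big => [w|w].
  rewrite !powersetE setU11 andbT; apply/andP/idP => [[eW /eqP weq]|wF].
    have ew : e \notin w by rewrite -weq setD11.
    apply/subsetP => z zw; have /setU1P[ze|//] : z \in e |: F.
      by apply: (subsetP eW); rewrite inE zw orbT.
    by move: ew; rewrite -ze zw.
  by rewrite setUS // setU1K //; apply: contra eF; apply: (subsetP wF).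
move=> _; rewrite big_setU1 //= setU11 mulrCA mulrA; congr (_ * _ * _).
apply: eq_bigr => z zF; rewrite !inE; case: eqP => // ze.
by move: eF; rewrite -ze zF.
Qed.


(** Fubini for independent edges; later [F1] is the star of a vertex, revealed first. *)
Lemma Ex_setU F1 F2 f : [disjoint F1 & F2] ->
  Ex (F1 :|: F2) f = Ex F1 (fun w1 => Ex F2 (fun w2 => f (w1 :|: w2))).
Proof.
elim/set_ind: F1 f => [f _|e F1 eF1 IH f].
  by rewrite set0U Ex_set0; apply: eq_Ex => w _; rewrite set0U.
rewrite -setI_eq0 setIUl setU_eq0 !setI_eq0 disjoints1 => /andP[eF2 dF]; rewrite -setUA Ex_setU1; last first.
  by rewrite inE negb_or eF1.
rewrite Ex_setU1 // IH //; apply: eq_Ex => w _.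
rewrite Ex_add !Ex_scale; congr (_ + _ * _).
by apply: eq_Ex => w' _; rewrite setUA.
Qed.

Lemma Ex_cst F (c : R) : Ex F (fun _ => c) = c.
Proof.
elim/set_ind: F => [|e F eF IH]; first by rewrite Ex_set0.
by rewrite Ex_setU1 // -[RHS]IH; apply: eq_Ex => w _; ring.
Qed.

Lemma le_Ex F f g : {in F, forall e, 0 <= p e <= 1} ->
  (forall w, w \subset F -> f w <= g w) -> Ex F f <= Ex F g.
Proof.
move=> p01 fg; apply: ler_sum => w; rewrite powersetE => wF.
apply: ler_wpM2l (fg w wF); apply: prodr_ge0 => e /p01 /andP[p0 p1].
by case: ifP => // _; rewrite subr_ge0.
Qed.

Lemma Ex_ge0 F f : {in F, forall e, 0 <= p e <= 1} ->
  (forall w, w \subset F -> 0 <= f w) -> 0 <= Ex F f.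
Proof. by move=> p01 f0; rewrite -(Ex_cst F 0); apply: le_Ex. Qed.

(** The case of a single edge of probability [q], the index recording whether it is open. The
    coefficients of [(1 - q)^2] and [q^2] compare termwise, those of [q * (1 - q)] only as a sum. *)
Lemma four_functions_point (q a0 a1 b0 b1 c0 c1 d0 d1 : R) :
  0 <= q <= 1 -> 0 <= a0 -> 0 <= a1 -> 0 <= b0 -> 0 <= b1 ->
  0 <= c0 -> 0 <= c1 -> 0 <= d0 -> 0 <= d1 ->
  a0 * b0 <= c0 * d0 -> a0 * b1 <= c1 * d0 ->
  a1 * b0 <= c1 * d0 -> a1 * b1 <= c1 * d1 ->
  ((1 - q) * a0 + q * a1) * ((1 - q) * b0 + q * b1) <=
  ((1 - q) * c0 + q * c1) * ((1 - q) * d0 + q * d1).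
Proof.
move=> /andP[q0 q1] a0p a1p b0p b1p c0p c1p d0p d1p h00 h01 h10 h11.
(* Both products on the left are at most [P := c1 * d0], and their product is at
   most [P * (c0 * d1)]; expand [(P - a0 * b1) * (P - a1 * b0) >= 0]. *)
have cross : a0 * b1 + a1 * b0 <= c1 * d0 + c0 * d1.
  have [z|P0] := eqVneq (c1 * d0) 0.
    rewrite z in h01 h10 *; rewrite add0r (le_trans _ (mulr_ge0 c0p d1p)) //.
    by rewrite -[0](addr0 0) lerD.
  have Pp : 0 < c1 * d0 by rewrite lt_def P0 mulr_ge0.
  rewrite -(ler_pM2l Pp).
  have h : (a0 * b0) * (a1 * b1) <= (c0 * d0) * (c1 * d1).
    by apply: ler_pM => //; apply: mulr_ge0.
  have h' : 0 <= (c1 * d0 - a0 * b1) * (c1 * d0 - a1 * b0).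
    by apply: mulr_ge0; rewrite subr_ge0.
  by nra.
have r0 : 0 <= 1 - q by rewrite subr_ge0.
have t0 := ler_wpM2l (mulr_ge0 r0 r0) h00.
have t1 := ler_wpM2l (mulr_ge0 q0 q0) h11.
have t2 := ler_wpM2l (mulr_ge0 r0 q0) cross.
by nra.
Qed.

(* The Ahlswede-Daykin four functions theorem for product measures. *)
Lemma four_functions F (a b c d : {set E} -> R) :
  {in F, forall e, 0 <= p e <= 1} ->
  (forall w, 0 <= a w) -> (forall w, 0 <= b w) ->
  (forall w, 0 <= c w) -> (forall w, 0 <= d w) ->
  (forall w w', w \subset F -> w' \subset F ->
     a w * b w' <= c (w :|: w') * d (w :&: w')) ->
  Ex F a * Ex F b <= Ex F c * Ex F d.
Proof.
elim/set_ind: F a b c d => [|e F eF IH] a b c d p01 a0 b0 c0 d0 H.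
  by rewrite !Ex_set0; have := H set0 set0; rewrite setUid setIid; apply.
have pe : 0 <= p e <= 1 by apply: p01; rewrite setU11.
have /andP[q0 q1] := pe; rewrite -subr_ge0 in q1.
(* The induction hypothesis is used for the four functions averaged over the state of [e]; their
   pointwise inequality is the single-edge case. *)
rewrite !Ex_setU1 //; apply: IH.
- by move=> z zF; apply: p01; rewrite inE zF orbT.
- by move=> w; apply: addr_ge0; apply: mulr_ge0.
- by move=> w; apply: addr_ge0; apply: mulr_ge0.
- by move=> w; apply: addr_ge0; apply: mulr_ge0.
- by move=> w; apply: addr_ge0; apply: mulr_ge0.
move=> w w' wF w'F.
have ew : e \notin w by apply: contra eF; apply: (subsetP wF).
have ew' : e \notin w' by apply: contra eF; apply: (subsetP w'F).
have s (v : {set E}) : v \subset F -> v \subset e |: F.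
  by move=> vF; apply: subset_trans vF (subsetUr _ _).
have s1 (v : {set E}) : v \subset F -> e |: v \subset e |: F by exact: setUS.
apply: four_functions_point => //.
- exact: H (s _ wF) (s _ w'F).
- have -> : e |: (w :|: w') = w :|: (e |: w') by rewrite setUCA.
  have -> : w :&: w' = w :&: (e |: w').
    apply/setP => z; rewrite !inE; case: (eqVneq z e) => [->|//].
    by rewrite (negbTE ew).
  exact: H (s _ wF) (s1 _ w'F).
- have -> : e |: (w :|: w') = (e |: w) :|: w' by rewrite setUA.
  have -> : w :&: w' = (e |: w) :&: w'.
    apply/setP => z; rewrite !inE; case: (eqVneq z e) => [->|//].
    by rewrite (negbTE ew') !andbF.
  exact: H (s1 _ wF) (s _ w'F).
- rewrite setUUr setUIr; exact: H (s1 _ wF) (s1 _ w'F).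
Qed.

End Expectation.

(** * Deterministic facts on clusters of vertex sets and on separation *)

Section Connections.
Variable T : finType.
Implicit Types (F w : {set {set T}}) (A B S X Y : {set T}).

Definition clus w A : {set T} := [set z | [exists a in A, connected w a z]].

Definition neighb w (v : T) : {set T} := [set z | [set v; z] \in w].

Lemma connected_sym w y z : connected w y z = connected w z y.
Proof. by apply: sym_connect_sym => u v; rewrite setUC. Qed.

Lemma connected_edge w y z : [set y; z] \in w -> connected w y z.
Proof. by move=> yz; apply: connect1. Qed.

Lemma clusP w A z :
  reflect (exists2 a, a \in A & connected w a z) (z \in clus w A).
Proof. by rewrite inE; apply: (iffP exists_inP). Qed.

Lemma sub_clus w A : A \subset clus w A.
Proof. by apply/subsetP => a aA; apply/clusP; exists a => //; apply: connect0. Qed.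

Lemma clus_closed w A y z :
  y \in clus w A -> connected w y z -> z \in clus w A.
Proof.
move=> /clusP[a aA ay] yz; apply/clusP; exists a => //.
exact: connect_trans ay yz.
Qed.

(** Induction along an open path. Later bounds on clusters only have to exhibit a set closed under
    open edges. *)
Lemma clus_min w A Y : A \subset Y ->
  (forall y z, y \in Y -> [set y; z] \in w -> z \in Y) -> clus w A \subset Y.
Proof.
move=> AY Yc; apply/subsetP => z /clusP[a /(subsetP AY) aY /connectP[s]].
elim: s a aY => [|c s IH] a aY /= => [_ -> //|/andP[ac cs]].
exact: IH (Yc _ _ aY ac) cs.
Qed.

Lemma clusS w w' A B : w \subset w' -> A \subset B -> clus w A \subset clus w' B.
Proof.
move=> ww AB; apply: clus_min; first exact: subset_trans AB (sub_clus _ _).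
move=> y z yB yz; apply: clus_closed yB _; apply: connected_edge.
exact: (subsetP ww).
Qed.

Lemma in_clus1 w v z : (z \in clus w [set v]) = connected w v z.
Proof.
by apply/clusP/idP => [[a /set1P ->]//|vz]; exists v; rewrite ?set11.
Qed.

(* Only one source needs to be the centre of the star: after its edges are
   revealed, its open neighbours become sources. *)
Lemma clus_star w w' (v : T) A : v \in A ->
  (forall e, e \in w -> v \in e) -> clus (w :|: w') A = clus w' (A :|: neighb w v).
Proof.
move=> vA wv; apply/eqP; rewrite eqEsubset; apply/andP; split.
  apply: clus_min => [|y z yC]; first exact: subset_trans (subsetUl _ _) (sub_clus _ _).
  rewrite inE => /orP[yz|yz]; last exact: clus_closed yC (connected_edge yz).
  apply: (subsetP (sub_clus _ _)); rewrite !inE.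
  have /set2P[vy|vz] := wv _ yz; last by rewrite -vz vA.
  by rewrite vy yz orbT.
apply: clus_min => [|y z yC yz].
  rewrite subUset sub_clus; apply/subsetP => z; rewrite inE => vz.
  apply/clusP; exists v => //; apply: connected_edge.
  by rewrite inE vz.
by apply: clus_closed yC _; apply: connected_edge; rewrite inE yz orbT.
Qed.

Definition sep w A X : bool := [disjoint clus w A & X].

Lemma sepP w A X :
  reflect (forall a x, a \in A -> x \in X -> ~~ connected w a x) (sep w A X).
Proof.
rewrite /sep disjoint_subset; apply: (iffP subsetP) => [h a x aA xX|h z].
  apply/negP => ax; have /h : x \in clus w A by apply/clusP; exists a.
  by rewrite inE xX.
move=> /clusP[a aA az]; rewrite inE; apply/negP => zX.
by have /negP := h a z aA zX.
Qed.

Lemma connectedS w w' y z : w \subset w' -> connected w y z -> connected w' y z.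
Proof. by rewrite -!in_clus1 => ww; apply: (subsetP (clusS ww _)). Qed.

Lemma sepS w w' A B X Y : w' \subset w -> B \subset A -> Y \subset X ->
  sep w A X -> sep w' B Y.
Proof.
move=> ww BA YX /sepP h; apply/sepP => a x aB xY.
apply: contra (h a x (subsetP BA _ aB) (subsetP YX _ xY)).
exact: connectedS.
Qed.

Lemma sep_sym w A X : sep w A X = sep w X A.
Proof.
by apply/sepP/sepP => h a z aA zX; rewrite connected_sym; apply: h.
Qed.

Lemma sepUr w A X Y : sep w A (X :|: Y) = sep w A X && sep w A Y.
Proof.
apply/idP/andP => [h|[/sepP hX /sepP hY]].
  by split; apply: sepS h; rewrite ?subsetUl ?subsetUr.
by apply/sepP => a z aA /setUP[]; [apply: hX|apply: hY].
Qed.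

Lemma sep1r w A z : sep w A [set z] = (z \notin clus w A).
Proof. by rewrite /sep disjoint_sym disjoints1. Qed.

Lemma sep11 w v z : sep w [set v] [set z] = ~~ connected w v z.
Proof. by rewrite sep1r in_clus1. Qed.

Lemma clus_setU w A B : clus w (A :|: B) = clus w A :|: clus w B.
Proof.
apply/eqP; rewrite eqEsubset; apply/andP; split; last first.
  by rewrite subUset; apply/andP; split; apply: clusS; rewrite ?subsetUl ?subsetUr.
apply/subsetP => z /clusP[a /setUP[] aA az]; apply/setUP; [left|right];
  by apply/clusP; exists a.
Qed.

Lemma clus_isolated w v : (forall e, e \in w -> v \notin e) ->
  clus w [set v] = [set v].
Proof.
move=> iso; apply/eqP; rewrite eqEsubset sub_clus andbT; apply: clus_min => //.
by move=> y z /set1P -> /iso; rewrite set21.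
Qed.

(** A path from [a] that used an edge of [w] would reach [v], an endpoint of that edge; so it stays
    in [w']. *)
Lemma connected_star w w' v a b : (forall e, e \in w -> v \in e) ->
  ~~ connected (w :|: w') v a -> connected (w :|: w') a b = connected w' a b.
Proof.
move=> wv nva; rewrite connected_sym in nva.
apply/idP/idP; last by apply: connectedS; apply: subsetUr.
rewrite -!in_clus1; apply: (subsetP _ b); apply: clus_min (sub_clus _ _) _.
move=> y z; rewrite in_clus1 => ay; have ay' := connectedS (subsetUr w w') ay.
rewrite inE => /orP[yz|yz]; last first.
  by rewrite in_clus1; apply: connect_trans ay (connected_edge yz).
case/negP: nva; have /set2P[->//|->] := wv _ yz.
by apply: connect_trans ay' (connected_edge _); rewrite inE yz.
Qed.

Lemma sep_star w w' (v : T) A X : v \in A ->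
  (forall e, e \in w -> v \in e) -> sep (w :|: w') A X = sep w' (A :|: neighb w v) X.
Proof. by move=> vA wv; rewrite /sep (clus_star _ vA wv). Qed.

Lemma sep_isolated w A X : (forall e v, e \in w -> v \in A -> v \notin e) ->
  [disjoint A & X] -> sep w A X.
Proof.
move=> iso d; apply: disjointWl d; apply: clus_min => // y z yA yz.
by have := iso _ _ yz yA; rewrite set21.
Qed.

End Connections.

(** * The van den Berg-Kahn inequality and the comparison of separation probabilities *)

Section Percolation.
Variables (R : realFieldType) (T : finType) (p : {set T} -> R).
Implicit Types (F w : {set {set T}}) (A B S X Y : {set T}).

Definition prSep F A X : R := Ex p F (fun w => (sep w A X)%:R).

Lemma prSep_ge0 F A X : {in F, forall e, 0 <= p e <= 1} -> 0 <= prSep F A X.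
Proof. by move=> p01; apply: Ex_ge0 => // w _; apply: ler0n. Qed.

Lemma prSepS F A B X Y : {in F, forall e, 0 <= p e <= 1} ->
  B \subset A -> Y \subset X -> prSep F A X <= prSep F B Y.
Proof.
move=> p01 BA YX; apply: le_Ex => // w _; rewrite ler_nat.
by case: (boolP (sep w A X)) => // /(sepS (subxx w) BA YX) ->.
Qed.

Lemma indM_le (b1 b2 b3 b4 : bool) : (b1 -> b2 -> b3 && b4) ->
  b1%:R * b2%:R <= b3%:R * b4%:R :> R.
Proof.
move=> h; rewrite -!natrM ler_nat !mulnb.
by case: b1 b2 h => [] [] //= /(_ isT isT) ->.
Qed.

(* The van den Berg-Kahn inequality, by induction on the number of edges. *)
Lemma prSep_UI F A B X Y : {in F, forall e, 0 <= p e <= 1} ->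
  prSep F A X * prSep F B Y <=
  prSep F (A :|: B) (X :&: Y) * prSep F (A :&: B) (X :|: Y).
Proof.
have [n] := ubnP #|F|; elim: n F A B X Y => // n IH F A B X Y ltn p01.
have [/exists_inP[v /setIP[vA vB] /existsP[e /andP[eF ve]]]|noedge] :=
  boolP [exists v in A :&: B, exists e, (e \in F) && (v \in e)].
  (* [F1] is the star of the common source [v]. It contains [e], so strictly fewer edges remain in
     [F2]. *)
  pose F1 := [set e in F | v \in e]; pose F2 := [set e in F | v \notin e].
  have FE : F = F1 :|: F2.
    by apply/setP => z; rewrite !inE; case: (z \in F); case: (v \in z).
  have dF : [disjoint F1 & F2].
    rewrite -setI_eq0; apply/eqP/setP => z; rewrite !inE.
    by case: (z \in F); case: (v \in z).
  have p1 : {in F1, forall e, 0 <= p e <= 1}.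
    by move=> z; rewrite inE => /andP[/p01].
  have p2 : {in F2, forall e, 0 <= p e <= 1}.
    by move=> z; rewrite inE => /andP[/p01].
  have lt2 : (#|F2| < n)%N.
    rewrite -ltnS; apply: leq_trans ltn; rewrite ltnS; apply: proper_card.
    apply/properP; split; first by apply/subsetP => z; rewrite inE => /andP[].
    by exists e => //; rewrite inE eF ve.
  have split (C Z : {set T}) : v \in C -> prSep F C Z =
      Ex p F1 (fun w => prSep F2 (C :|: neighb w v) Z).
    move=> vC; rewrite /prSep FE Ex_setU //; apply: eq_Ex => w wF.
    apply: eq_Ex => w' _; rewrite (sep_star _ _ vC) // => z zw.
    by have := subsetP wF _ zw; rewrite inE => /andP[].
  rewrite !split ?inE ?vA ?vB //.
  apply: four_functions => //; try by move=> w; apply: prSep_ge0.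
  move=> w w' _ _; apply: le_trans (IH _ _ _ _ _ lt2 p2) _.
  (* Open neighbourhoods commute with unions and intersections of configurations, so the required
     source sets are contained in those given by the induction hypothesis. Fewer sources are more
     likely to be separated. *)
  apply: ler_pM; rewrite ?prSep_ge0 //; apply: prSepS => //.
    apply/subsetP => z; rewrite !inE.
    by do 4 case: (_ \in _).
  apply/subsetP => z; rewrite !inE.
  by do 4 case: (_ \in _).
(* The common sources are isolated, so Harris' inequality suffices. *)
have [d|/pred0Pn[z /andP[/setIP[zA zB] zXY]]] :=
  boolP [disjoint A :&: B & X :|: Y]; last first.
  (* A source that is also a target is joined to itself, so a factor on the left is zero. *)
  have [zX|zY] := setUP zXY.
    rewrite {1}/prSep (_ : Ex _ _ _ = 0) ?mul0r; last first.
      rewrite -(Ex_cst p F 0); apply: eq_Ex => w _.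
      by case: sepP => // /(_ z z zA zX); rewrite /connected connect0.
    by rewrite mulr_ge0 // prSep_ge0.
  rewrite {2}/prSep (_ : Ex _ _ _ = 0) ?mulr0; last first.
    rewrite -(Ex_cst p F 0); apply: eq_Ex => w _.
    by case: sepP => // /(_ z z zB zY); rewrite /connected connect0.
  by rewrite mulr_ge0 // prSep_ge0.
have -> : prSep F (A :&: B) (X :|: Y) = 1.
  rewrite -(Ex_cst p F 1); apply: eq_Ex => w wF.
  rewrite sep_isolated // => e v ew vAB; apply: contra noedge => ve.
  by apply/exists_inP; exists v => //; apply/existsP; exists e; rewrite (subsetP wF).
(* Harris' inequality is the four functions theorem with [c] constantly 1: closing edges preserves
   separation, so both events persist in [w :&: w']. *)
rewrite mulr1 mulrC -[prSep F (A :|: B) _]mul1r -{1}(Ex_cst p F 1).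
rewrite /prSep; apply: four_functions => // w w' _ _; rewrite mul1r.
apply: le_trans (indM_le (b3 := true) (b4 := sep (w :&: w') (A :|: B) (X :&: Y)) _) _.
  move=> /sepP h /sepP h'; apply/sepP => a x /setUP[aA|aB] /setIP[xX xY].
    apply: contra (h' a x aA xX); apply: connectedS; exact: subsetIr.
  apply: contra (h a x aB xY); apply: connectedS; exact: subsetIl.
by rewrite mul1r.
Qed.

(** In the notation of the proof, the hypothesis amounts to [u <= v], and the two van den Berg-Kahn
    bounds chain to [prSep F S [set a; b] * d <= D * u <= D * v <= d * prSep F [set a] (b |: S)];
    then [d] is cancelled. *)
Lemma prSep_compare F a s S b : {in F, forall e, 0 <= p e <= 1} ->
  s \in S -> b \notin S ->
  Ex p F (fun w => (connected w a b)%:R) <= Ex p F (fun w => (connected w s b)%:R) ->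
  prSep F S [set a; b] <= prSep F [set a] (b |: S).
Proof.
move=> p01 sS bS le_ab.
have symE A X : prSep F A X = prSep F X A.
  by apply: eq_Ex => w _; rewrite sep_sym.
set d := prSep F [set a] [set s]; set D := prSep F [set a] S.
set u := prSep F [set s] [set a; b]; set v := prSep F [set a] [set s; b].
have u_le_v : u <= v.
  (* If [a] and [s] are joined, their connections to [b] agree and both separations fail; otherwise
     each connection is complementary to its separation. *)
  suff : Ex p F (fun w => (connected w a b)%:R) + v =
         Ex p F (fun w => (connected w s b)%:R) + u by lra.
  rewrite -!Ex_add; apply: eq_Ex => w _.
  rewrite !sepUr !sep11 (connected_sym w s a).
  have [as_|nas] := boolP (connected w a s); rewrite /= ?addr0.
    have -> // : connected w a b = connected w s b.
    apply/idP/idP; last exact: connect_trans as_.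
    by apply: connect_trans; rewrite -/(connected w s a) connected_sym.
  by do 2 case: (connected w _ _); rewrite ?addr0 ?add0r.
have H1 : prSep F S [set a; b] * d <= D * u.
  rewrite /d /D !(symE [set a]); apply: le_trans (prSep_UI _ _ _ _ p01) _.
  have /setUidPl -> : [set s] \subset S by rewrite sub1set.
  have /setIidPr -> : [set s] \subset S by rewrite sub1set.
  have /setUidPl -> : [set a] \subset [set a; b] by rewrite subsetUl.
  by have /setIidPr -> : [set a] \subset [set a; b] by rewrite subsetUl.
have H2 : v * D <= d * prSep F [set a] (b |: S).
  apply: le_trans (prSep_UI _ _ _ _ p01) _; rewrite setUid setIid.
  have -> : [set s; b] :&: S = [set s].
    apply/setP => z; rewrite !inE; have [->|_] := eqVneq z s; rewrite ?sS //=.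
    by have [->|] := eqVneq z b; rewrite ?(negbTE bS).
  have -> // : [set s; b] :|: S = b |: S.
  by rewrite setUAC setUC; have /setUidPr -> : [set s] \subset S by rewrite sub1set.
have d0 : 0 <= d by apply: prSep_ge0.
have D0 : 0 <= D by apply: prSep_ge0.
(* When [d] cannot be cancelled, the left side is zero, being at most [d]. *)
have [dz|dnz] := eqVneq d 0.
  apply: le_trans (prSep_ge0 _ _ p01); rewrite -dz /d symE.
  by apply: prSepS; rewrite ?sub1set ?set21.
have dp : 0 < d by rewrite lt_def dnz.
rewrite -(ler_pM2r dp); apply: le_trans H1 _.
by rewrite [leRHS]mulrC; apply: le_trans H2; rewrite mulrC ler_wpM2r.
Qed.

(** Once the star [w] of [o] is fixed, the cluster of [o] is that of [S] in the remaining edges. If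
    it contains [a], both connections to [b] agree; if not, they are complementary to the two
    separations of [prSep_compare]. *)
Lemma connected_star_le F w o a s b : {in F, forall e, 0 <= p e <= 1} ->
  (forall e, e \in w -> o \in e) -> s \in neighb w o ->
  b \notin o |: neighb w o ->
  Ex p F (fun w => (connected w a b)%:R) <= Ex p F (fun w => (connected w s b)%:R) ->
  Ex p F (fun w' => (connected (w :|: w') a b)%:R) <=
  Ex p F (fun w' => (connected (w :|: w') o b)%:R).
Proof.
move=> p01 wo sN; set S := o |: _ => bS le_ab.
have sS : s \in S by rewrite inE sN orbT.
have := prSep_compare p01 sS bS le_ab.
suff : Ex p F (fun w' => (connected (w :|: w') a b)%:R) + prSep F [set a] (b |: S) =
  Ex p F (fun w' => (connected (w :|: w') o b)%:R) + prSep F S [set a; b] by lra.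
rewrite -!Ex_add; apply: eq_Ex => w' _.
have cE z : connected (w :|: w') o z = (z \in clus w' S).
  by rewrite -in_clus1 (clus_star _ (set11 o) wo).
rewrite (sepUr _ _ [set b] S) (sepUr _ S [set a]) (sep_sym _ _ S) !sep1r in_clus1 -!cE.
have [oa|noa] := boolP (connected (w :|: w') o a); rewrite ?andbF ?addr0.
  congr (_%:R); congr nat_of_bool; apply/idP/idP; first exact: connect_trans.
  by apply: connect_trans; rewrite -/(connected _ a o) connected_sym.
rewrite (connected_star _ wo noa) andbT.
by do 2 case: (connected _ _ _); rewrite ?addr0 ?add0r.
Qed.

End Percolation.

(** * Graph probabilities and minima expressed as expectations *)

Section Graphs.
Variables (R : realType) (T : finType) (p : {set T} -> R).
Implicit Types (G H : graph T) (A W : {set T}).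

Lemma clusterE (w : {set {set T}}) v : cluster w v = clus w [set v].
Proof. by apply/setP => z; rewrite in_clus1 inE. Qed.

Lemma PrE G (P : pred {set {set T}}) :
  Pr p G P = Ex p (eset G) (fun w => (P w)%:R).
Proof.
rewrite /Pr big_mkcondr; apply: eq_bigr => w _.
by rewrite mulr_natr; case: (P w).
Qed.

Lemma prConnE G v z :
  prConn p G v z = Ex p (eset G) (fun w => (connected w v z)%:R).
Proof. exact: PrE. Qed.

Lemma prConn_ge0 G v z : {in eset G, forall e, 0 <= p e <= 1} ->
  0 <= prConn p G v z.
Proof. by move=> p01; rewrite prConnE; apply: Ex_ge0 => // w _; apply: ler0n. Qed.

Lemma prConn_le1 G v z : {in eset G, forall e, 0 <= p e <= 1} ->
  prConn p G v z <= 1.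
Proof.
move=> p01; rewrite prConnE -[leRHS](Ex_cst p (eset G)); apply: le_Ex => // w _.
by rewrite lern1 leq_b1.
Qed.

Lemma minConn_le G A b a : a \in A -> minConn p G A b <= prConn p G a b.
Proof. by move=> aA; apply: bigmin_le_cond. Qed.

Lemma minConn_ge0 G A b : {in eset G, forall e, 0 <= p e <= 1} ->
  0 <= minConn p G A b.
Proof. by move=> p01; apply/bigmin_geP; split=> // a _; apply: prConn_ge0. Qed.

(** Probabilities are at most 1, so the default value 1 cannot undercut the values over the nonempty
    set [A]. *)
Lemma minConn_attained G A b : {in eset G, forall e, 0 <= p e <= 1} ->
  A != set0 -> exists2 a, a \in A & minConn p G A b = prConn p G a b.
Proof.
move=> p01 /set0Pn[a0 a0A]; rewrite /minConn (bigmin_eq_arg _ a0) => // [|a _].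
  by case: arg_minP => // a aA _; exists a.
exact: prConn_le1.
Qed.

(** Only edges matter, so successive deletions can be compared without equating vertex sets. *)
Lemma eq_minConn G H A b : eset G = eset H -> minConn p G A b = minConn p H A b.
Proof. by move=> GH; apply: eq_bigr => a _; rewrite !prConnE GH. Qed.

Lemma eset_sub G e v : e \in eset G -> v \in e -> v \in vset G.
Proof.
by have /forall_inP h := eset_wf G => /h /andP[/subsetP eV _]; apply: eV.
Qed.

Lemma cluster_sub G (w : {set {set T}}) v : v \in vset G -> w \subset eset G ->
  cluster w v \subset vset G.
Proof.
move=> vG wG; rewrite clusterE; apply: clus_min => [|y z _ yz].
  by rewrite sub1set.
by apply: eset_sub (subsetP wG _ yz) (set22 _ _).
Qed.

(** For each configuration only the actual cluster of [u] contributes. The resulting expectation can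
    then be conditioned on the star of a vertex. *)
Lemma sum_prCluster G A u (h : {set T} -> R) : u \in vset G ->
  \sum_(W in powerset (vset G) | [disjoint W & A]) prCluster p G u W * h W =
  Ex p (eset G) (fun w => [disjoint cluster w u & A]%:R * h (cluster w u)).
Proof.
move=> uG; under eq_bigr do rewrite /prCluster PrE mulrC -Ex_scale.
rewrite -Ex_sum; apply: eq_Ex => w wG.
have [d|nd] := boolP [disjoint cluster w u & A].
  rewrite (bigD1 (cluster w u)) /=; last by rewrite powersetE cluster_sub.
  rewrite eqxx big1 ?addr0 ?mulr1 ?mul1r // => W /andP[_].
  by rewrite eq_sym => /negbTE ->; rewrite mulr0.
rewrite mul0r big1 // => W /andP[_ dW]; case: eqP => [cW|]; rewrite ?mulr0 //.
by rewrite cW dW in nd.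
Qed.

Lemma eset_delvU G (W W' : {set T}) :
  eset (delv G (W :|: W')) = eset (delv (delv G W) W').
Proof.
apply/setP => e; rewrite !inE -andbA; congr (_ && _).
by rewrite -!setI_eq0 setIUr setU_eq0.
Qed.

Lemma delv_p01 G W : {in eset G, forall e, 0 <= p e <= 1} ->
  {in eset (delv G W), forall e, 0 <= p e <= 1}.
Proof. by move=> p01 e; rewrite inE => /andP[/p01]. Qed.

End Graphs.

Theorem theorem5 (R : realType) (T : finType) (G : graph T) (p : {set T} -> R)
    (p01 : forall e, e \in eset G -> 0 <= p e <= 1)
    (A : {set T}) (AG : A \subset vset G) (A0 : A != set0)
    (o b : T) (oGA : o \in vset G :\: A) (bGA : b \in vset G :\: A)
    (ob : o != b)
    (x : T) (xGA : x \in vset G :\: A) (xo : x != o)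
    (xgood : good p (delv G [set o]) A x b)
    (oiso : isolated (delv G (x |: A)) o) :
  good p G A o b.
Proof.
have [oG oA] := setDP oGA; have [bG bA] := setDP bGA.
have [xG xA] := setDP xGA.
case: xgood; set H := delv G [set o] => _ _ _ dxb ineq.
have nbr z : [set o; z] \in eset G -> z \in x |: A.
  move=> oz; case/andP: oiso => _ /forall_inP/(_ [set o; z]).
  rewrite inE oz /= set21 => h; apply: contraT => zxA.
  suff /h : [disjoint [set o; z] & x |: A] by [].
  rewrite -setI_eq0 setIUl setU_eq0 !setI_eq0 !disjoints1 zxA andbT !inE.
  by rewrite eq_sym (negbTE xo) (negbTE oA).
have bx : b != x.
  apply: contraTneq dxb => ->; apply/pred0Pn; exists x => /=.
  by rewrite !inE /connected connect0.
split; rewrite ?inE ?oG ?oA ?bG ?bA //.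
  (* Outside [A] the only possible neighbour of [o] is [x], so the component of [o] extends only
     through that of [x]. *)
  have sub : component (delv G A) o \subset o |: component (delv H A) x.
    rewrite /component !clusterE; apply: clus_min => [|y z].
      by rewrite sub1set setU11.
    have [->|zo] := eqVneq z o; first by rewrite setU11.
    move=> yC; rewrite inE => /andP[yzG yzA]; apply/setU1P; right.
    have [yo|yo] := eqVneq y o.
      have := nbr z; rewrite -yo => /(_ yzG)/setU1P[->|zA].
        exact: (subsetP (sub_clus _ _) _ (set11 x)).
      by move/pred0P: yzA => /(_ z); rewrite /= set22 zA.
    case/setU1P: yC yo => [->|yC yo]; first by rewrite eqxx.
    apply: clus_closed yC (connected_edge _).
    rewrite !inE yzG yzA andbT /= -setI_eq0 setIUl setU_eq0 !setI_eq0 !disjoints1.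
    by rewrite !inE yo zo.
  apply/pred0P => z /=; apply/negP => /andP[]; rewrite ![_ \in component _ _]inE => oz bz.
  have /setU1P[bo|xb] : b \in o |: component (delv H A) x.
    apply: (subsetP sub); rewrite inE; apply: connect_trans oz _.
    by rewrite -/(connected _ z b) connected_sym.
    by rewrite bo eqxx in ob.
  by move/pred0P: dxb => /(_ b) /=; rewrite xb inE /connected connect0.
have p01H : {in eset H, forall e, 0 <= p e <= 1} by apply: delv_p01.
pose F1 := [set e in eset G | o \in e].
have GE : eset G = F1 :|: eset H.
  apply/setP => e; rewrite !inE disjoint_sym disjoints1.
  by case: (e \in eset G); case: (o \in e).
have dF : [disjoint F1 & eset H].
  rewrite -setI_eq0; apply/eqP/setP => e; rewrite !inE disjoint_sym disjoints1.
  by case: (e \in eset G); case: (o \in e).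
have p01F : {in F1, forall e, 0 <= p e <= 1} by move=> e; rewrite inE => /andP[/p01].
(* The minimiser is taken in [H]; in [G] the vertex [a] still bounds the minimum from above, as the
   left side needs. *)
have [a aA aE] := minConn_attained b p01H A0.
have ao : a != o by apply: contraTneq aA => ->.
rewrite lerBlDr; apply: le_trans (minConn_le p G b aA) _.
rewrite !prConnE sum_prCluster // GE !Ex_setU // -Ex_add.
(* From here the open star [w1] of [o] is fixed, and only the edges of [H] are random. *)
apply: le_Ex => // w1 w1F.
have w1o e : e \in w1 -> o \in e by move/(subsetP w1F); rewrite inE => /andP[].
have w1G z : z \in neighb w1 o -> z \in x |: A.
  by rewrite inE => /(subsetP w1F); rewrite inE => /andP[/nbr].
have term_ge0 w2 : 0 <= [disjoint cluster (w1 :|: w2) o & A]%:R *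
    minConn p (delv G (cluster (w1 :|: w2) o)) A b.
  by rewrite mulr_ge0 ?ler0n // minConn_ge0 //; apply: delv_p01.
have [dNA|/pred0Pn[s /andP[sN sA]]] := boolP [disjoint neighb w1 o & A]; last first.
  (* With an open neighbour [s] in [A], the cluster term is dropped as nonnegative and the
     connection terms alone are compared. *)
  rewrite -[leLHS]addr0 lerD ?Ex_ge0 //.
  apply: (connected_star_le (s := s)) => //.
    rewrite !inE negb_or eq_sym ob; apply/negP => bo1.
    by have := w1G b; rewrite inE bo1 !inE (negbTE bx) (negbTE bA) => /(_ isT).
  by rewrite -!prConnE -aE minConn_le.
have Nx z : z \in neighb w1 o -> z = x.
  move=> zN; have /setU1P[//|zA] := w1G z zN.
  by move/pred0P: dNA => /(_ z) /=; rewrite zN zA.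
have w2o (w2 : {set {set T}}) : w2 \subset eset H -> forall e, e \in w2 -> o \notin e.
  by move=> w2H e /(subsetP w2H); rewrite inE disjoint_sym disjoints1 => /andP[].
have oclus (w2 : {set {set T}}) : w2 \subset eset H ->
    clus (w1 :|: w2) [set o] = o |: clus w2 (neighb w1 o).
  move=> w2H; rewrite (clus_star _ (set11 o)) // clus_setU clus_isolated //.
  exact: w2o.
(* At most the edge from [o] to [x] is open in the star, so [o] is a dead end and creates no new
   connection between [a] and [b]. *)
have a_le : Ex p (eset H) (fun w2 => (connected (w1 :|: w2) a b)%:R) <=
    prConn p H a b.
  rewrite prConnE; apply: le_Ex => // w2 w2H; rewrite ler_nat.
  have [oa|noa] := boolP (connected (w1 :|: w2) o a); last first.
    by rewrite (connected_star _ w1o noa).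
  case: (boolP (connected (w1 :|: w2) a b)) => // ab.
  have mem z : z != o -> connected (w1 :|: w2) o z -> connected w2 x z.
    move=> zo; rewrite -in_clus1 oclus // !inE (negbTE zo) /=.
    by move=> /exists_inP[y /Nx ->].
  have xa := mem a ao oa.
  have xb : connected w2 x b by apply: mem; [rewrite eq_sym|apply: connect_trans oa ab].
  by rewrite lt0b; apply: connect_trans xb; rewrite -/(connected w2 a x) connected_sym.
apply: le_trans a_le _; rewrite -aE.
have [xN|xN] := boolP (x \in neighb w1 o); last first.
  have N0 : neighb w1 o = set0.
    by apply/setP => z; rewrite in_set0; apply/negP => zN; rewrite -(Nx z zN) zN in xN.
  (* Here the cluster of [o] is [[set o]], whose deletion leaves [H], so the cluster term alone
     equals [minConn p H A b]. *)
  rewrite -[leLHS]add0r lerD ?Ex_ge0 // -(Ex_cst p (eset H) (minConn p H A b)).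
  apply: le_Ex => // w2 w2H; rewrite clusterE oclus // N0.
  have -> : clus w2 set0 = set0.
    by apply/setP => z; rewrite in_set0; apply/clusP => -[y]; rewrite inE.
  by rewrite setU0 disjoints1 oA mul1r.
have N1 : neighb w1 o = [set x].
  by apply/setP => z; rewrite in_set1; apply/idP/eqP => [/Nx|->].
have xH : x \in vset H by rewrite inE xG andbT in_set1.
(* With [x] the only open neighbour, the cluster of [o] is that of [x] in [H] together with [o], and
   deleting it from [G] leaves the same edges as deleting the cluster of [x] from [H]. *)
rewrite lerBlDr sum_prCluster // prConnE in ineq; apply: le_trans ineq _.
apply: lerD; apply: le_Ex => // w2 w2H.
  rewrite ler_nat; case: (boolP (connected w2 x b)) => // xb.
  by rewrite lt0b -in_clus1 oclus // N1 in_setU (in_clus1 w2) xb orbT.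
rewrite !clusterE oclus // N1 (_ : [disjoint o |: _ & A] = [disjoint clus w2 [set x] & A]).
  by rewrite (eq_minConn p A b (eset_delvU G [set o] _)).
by rewrite -setI_eq0 setIUl setU_eq0 !setI_eq0 disjoints1 oA.
Qed.
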